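(* Let $X$ and $A$ be nonempty sets and let $F\colon A\to\mathcal P(X)$ be a soft set with $F(t)\neq\varnothing$ for every $t\in A$ and $\mathrm{SE}(F)\neq\varnothing$. If $(F,\tau_1,\tau_2)$ is a soft bitopological space, then $(\mathrm{SE}(F),\tau_1^{\mathrm e},\tau_2^{\mathrm e})$ is a bitopological space, i.e. $\tau_1^{\mathrm e}$ and $\tau_2^{\mathrm e}$ are both topologies on the set $\mathrm{SE}(F)$.
   Context: A soft set over $X$ with parameter set $A$ is a map $H\colon A\to\mathcal P(X)$; it is a soft subset of $F$, written $H\subseteq_s F$, if $H(t)\subseteq F(t)$ for every $t\in A$. Soft unions (arbitrary) and soft intersections (finite) are taken pointwise in $t$. The null soft set $\Phi$ is $\Phi(t)=\varnothing$ for all $t\in A$. A soft element of $F$ is a map $a\colon A\to X$ with $a(t)\in F(t)$ for every $t\in A$; $\mathrm{SE}(F)$ is the set of all soft elements of $F$. For $H\subseteq_s F$, $\mathrm{SE}(H)=\{a\in\mathrm{SE}(F):a(t)\in H(t)\text{ for every }t\in A\}$. A soft topology on $F$ is a family $\tau$ of soft subsets of $F$ with $\Phi,F\in\tau$, closed under arbitrary soft unions and finite soft intersections. For a soft topology $\tau$ on $F$, $\tau^{\mathrm e}=\{\bigcup_{H\in\mathcal H}\mathrm{SE}(H):\mathcal H\subseteq\tau\}$ (the induced soft-element topology). A soft bitopological space is a triple $(F,\tau_1,\tau_2)$ where $\tau_1,\tau_2$ are soft topologies on the same soft set $F$. A bitopological space is a triple $(Y,\sigma_1,\sigma_2)$ with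 $\sigma_1,\sigma_2$ topologies on the set $Y$. *)

(* Defs.v *)
From mathcomp Require Import all_boot all_classical.

Set Implicit Arguments.
Unset Strict Implicit.
Unset Printing Implicit Defensive.

Local Open Scope classical_set_scope.

Definition soft_set (A X : Type) := A -> set X.

Section SoftSets.
Variables A X : Type.
Implicit Types (F H : soft_set A X) (HH tau : set (soft_set A X)).

Definition soft_subset H F := forall t, H t `<=` F t.

Definition soft_null : soft_set A X := fun=> set0.

Definition soft_bigcup HH : soft_set A X := fun t => \bigcup_(H in HH) H t.

Definition soft_bigcap HH : soft_set A X := fun t => \bigcap_(H in HH) H t.

Definition SE F : set (A -> X) := [set a | forall t, F t (a t)].

(* SE(H) for H a soft subset of the ambient soft set F. *)
Definition SE_sub F H : set (A -> X) :=
  [set a | SE F a /\ forall t, H t (a t)].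

(* The empty intersection, relative to F, is F itself; it is covered by
   [soft_top_full], so that only nonempty finite families are considered in
   [soft_top_bigcap]. *)
Record soft_topology F tau : Prop := SoftTopology {
  soft_top_sub : forall H, tau H -> soft_subset H F;
  soft_top_null : tau soft_null;
  soft_top_full : tau F;
  soft_top_bigcup : forall HH, HH `<=` tau -> tau (soft_bigcup HH);
  soft_top_bigcap : forall HH, finite_set HH -> HH !=set0 -> HH `<=` tau ->
    tau (soft_bigcap HH) }.

Definition soft_bitopological F tau1 tau2 : Prop :=
  soft_topology F tau1 /\ soft_topology F tau2.

Definition soft_element_topology F tau : set (set (A -> X)) :=
  [set \bigcup_(H in HH) SE_sub F H | HH in [set HH | HH `<=` tau]].

End SoftSets.

(* A topology on a set Y of elements of T, as the family of its open sets;
   unlike [topologicalType], Y need not be a whole type. As above, the empty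
   intersection relative to Y is Y. *)
Record topology_on (T : Type) (Y : set T) (sigma : set (set T)) : Prop :=
  TopologyOn {
    top_sub : forall U, sigma U -> U `<=` Y;
    top_empty : sigma set0;
    top_full : sigma Y;
    top_bigcup : forall UU, UU `<=` sigma -> sigma (\bigcup_(U in UU) U);
    top_bigcap : forall UU, finite_set UU -> UU !=set0 -> UU `<=` sigma ->
      sigma (\bigcap_(U in UU) U) }.

Definition bitopological (T : Type) (Y : set T) (sigma1 sigma2 : set (set T)) :
  Prop := topology_on Y sigma1 /\ topology_on Y sigma2.

(* Main.v *)
(* A family of the form tau^e consists of the U that are neighbourhoods, in
   the sense of tau, of each of their points. This local description passes to
   unions at once, and to finite intersections because SE turns a soft
   intersection into an intersection of sets. *)
Require Import Defs.
From mathcomp Require Import all_boot all_classical.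

Local Open Scope classical_set_scope.

Lemma soft_element_topologyP {A X : Type} (F : soft_set A X)
    (tau : set (soft_set A X)) (U : set (A -> X)) :
  soft_element_topology F tau U <->
  forall a, U a -> exists H, [/\ tau H, SE_sub F H a & SE_sub F H `<=` U].
Proof.
split=> [[HH HHtau <-] a [H HHH Ha]|nbhU].
  by exists H; split=> //; [exact: HHtau | exact: bigcup_sup].
(* The largest possible family: every [H] in [tau] whose soft elements all lie in [U]; [nbhU] makes
   it cover [U]. *)
exists [set H | tau H /\ SE_sub F H `<=` U]; first by move=> H [].
apply/seteqP; split=> [a [H [_ HU] Ha]|a Ua]; first exact: HU.
by have [H [tauH Ha HU]] := nbhU _ Ua; exists H.
Qed.

Lemma topology_on_soft_element_topology {A X : Type} (F : soft_set A X)
    (tau : set (soft_set A X)) :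
  soft_topology F tau -> topology_on (SE F) (soft_element_topology F tau).
Proof.
move=> tauT; split.
- by move=> _ [HH _ <-] a [H _ []].
- by apply/soft_element_topologyP.
- apply/soft_element_topologyP => a Fa; exists F.
  by split=> [||b []//]; first exact: soft_top_full tauT.
- move=> UU UUtau; apply/soft_element_topologyP => a [U UUU Ua].
  have /soft_element_topologyP/(_ a Ua)[H [tauH Ha HU]] := UUtau _ UUU.
  by exists H; split=> // b /HU Ub; exists U.
move=> UU finUU [U0 UU0] UUtau; apply/soft_element_topologyP => a UUa.
(* Fixing one neighbourhood [h U] of [a] for each [U] lets the finiteness of [UU] pass to the chosen
   soft sets. Outside [UU], [F] is a default value. *)
have /choice[h hP] (U : set (A -> X)) : exists H, UU U ->
    [/\ tau H, SE_sub F H a & SE_sub F H `<=` U].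
  have [UUU|nUU] := pselect (UU U); last by exists F.
  have /soft_element_topologyP/(_ a (UUa _ UUU))[H HP] := UUtau _ UUU.
  by exists H.
exists (soft_bigcap (h @` UU)); split.
- apply: (soft_top_bigcap tauT); first exact: finite_image.
    by exists (h U0), U0.
  by move=> _ [U /hP[tauU _ _] <-].
(* That [a] is a soft element of [F] is read off at [U0]. *)
- have [_ [Fa _] _] := hP _ UU0.
  by split=> // t _ [U /hP[_ [_ ha] _] <-]; exact: ha.
(* Pointwise, [b] takes its values in every [h U], so it lies in every [U]. *)
- move=> b [Fb hb] U UUU; have [_ _] := hP _ UUU; apply.
  by split=> // t; apply: (hb t); exists U.
Qed.

Theorem theorem3p11 (X A : Type) (hX : inhabited X) (hA : inhabited A)
    (F : soft_set A X) (hF : forall t : A, F t !=set0) (hSE : SE F !=set0)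
    (tau1 tau2 : set (soft_set A X)) (htau : soft_bitopological F tau1 tau2) :
  bitopological (SE F) (soft_element_topology F tau1)
    (soft_element_topology F tau2).
Proof.
by case: htau => tau1T tau2T; split; exact: topology_on_soft_element_topology.
Qed.
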